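(* Let $f\in\mathbb{R}[X]$ be a polynomial of odd degree $d\geq 3$ with negative leading coefficient, and let $f^2=f\circ f$. Then $\mathrm{J}(f)\subseteq\mathbb{R}$ if and only if $\mathrm{Fix}(f^{2},\mathbb{R})\subseteq\mathrm{I}(f^{2})$.
   Context: $\mathrm{J}(f)\subseteq\mathbb{P}^1(\mathbb{C})$ is the Julia set of $f$, i.e. the complement of the maximal open subset of $\mathbb{P}^1(\mathbb{C})$ on which the family of iterates of $f$ is equicontinuous. For a polynomial $g\in\mathbb{R}[X]$, $\mathrm{Fix}(g,\mathbb{R})=\{x\in\mathbb{R}: g(x)=x\}$. For $g\in\mathbb{R}[X]$ of degree $e\ge2$, the critical interval $\mathrm{I}(g)$ is the set of all $t\in\mathbb{R}$ such that $g(X)=t$ has $e$ real solutions counted with multiplicity. *)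

(* Defs.v *)
From HB Require Import structures.
From mathcomp Require Import all_boot all_order all_algebra.
From mathcomp Require Import all_classical all_reals all_analysis.
From mathcomp Require Import complex.

Set Implicit Arguments.
Unset Strict Implicit.
Unset Printing Implicit Defensive.

Import Order.TTheory GRing.Theory Num.Theory.
Import numFieldNormedType.Exports.

Local Open Scope classical_set_scope.
Local Open Scope ring_scope.

(** The Riemann sphere. [None] is the point at infinity, and [stereo] is the
    inverse stereographic projection onto the unit sphere of R^3. The uniform
    structure of [P1 R] is the one induced by this embedding, i.e. the one of
    the chordal metric. *)
Definition stereo (R : realType) (p : option R[i]) : R * R * R :=
  if p is Some z then
    let s := complex.Re z ^+ 2 + complex.Im z ^+ 2 in
    (2 * complex.Re z / (1 + s), 2 * complex.Im z / (1 + s), (s - 1) / (1 + s))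
  else (0, 0, 1).

Definition P1 (R : realType) : puniformType := initial_topology (@stereo R).

(** The self-map of P^1(C) given by a real polynomial; sending infinity to
    itself is the right extension only for nonconstant polynomials. *)
Definition P1_map (R : realType) (f : {poly R}) (p : P1 R) : P1 R :=
  if p is Some z then Some (map_poly (real_complex R) f).[z] else None.

(** Equicontinuity at the points of [U] of the restrictions to [U] of the
    iterates of [F]. *)
Definition equicontinuous_iter (X : puniformType) (F : X -> X) (U : set X) :=
  @equicontinuous (subspace U) X nat setT (fun n => iter n F).

Definition fatou (X : puniformType) (F : X -> X) : set X :=
  \bigcup_(U in [set U | open U /\ equicontinuous_iter F U]) U.

(** [fatou F] is the maximal open set on which the iterates are
    equicontinuous: it is such a set, and contains every other one. *)
Lemma fatou_maximal (X : puniformType) (F : X -> X) :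
  [/\ open (fatou F), equicontinuous_iter F (fatou F) &
      forall U : set X, open U -> equicontinuous_iter F U -> U `<=` fatou F].
Proof.
have oF : open (fatou F) by apply: bigcup_open => U [].
split=> //; last by move=> U oU eU; apply: bigcup_sup.
move=> x E entE; have [Fx|nFx] := pselect (fatou F x); last first.
  rewrite /prop_near1 /nbhs/= -nbhs_subspace_out// => y -> i _.
  exact: entourage_refl.
case: (Fx) => U [oU eU] Ux; have := eU x E entE.
rewrite /prop_near1 ![nbhs (_ : subspace _)]/nbhs/= -!nbhs_subspace_in//.
rewrite /within/= => H.
have nU : nbhs (x : X) U by exact: open_nbhs_nbhs.
by apply: filterS2 nU H => y Uy /(_ Uy).
Qed.

Definition julia (X : puniformType) (F : X -> X) : set X := ~` fatou F.

Definition real_line (R : realType) : set (P1 R) :=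
  range (fun x : R => Some (x%:C)%C : P1 R).

Definition Fix (R : realType) (g : {poly R}) : set R := [set x | g.[x] = x].

(** [(size g).-1] is the degree of [g]; solutions of [g(X) = t] are counted
    with the multiplicity [mup]. *)
Definition critical_interval (R : realType) (g : {poly R}) : set R :=
  [set t | (\big[addn/0%N]_(x \in [set x : R | g.[x] = t]) mup x (g - t%:P))%N
           = (size g).-1].

(* Main.v *)
Require Import Defs.
From mathcomp Require Import all_boot all_order all_algebra.
From mathcomp Require Import all_classical all_reals all_analysis.
From mathcomp Require Import complex polyrcf ring lra.

(** Put g = f \Po f, which has odd degree and positive leading coefficient, and
    let a and b be its smallest and largest real fixed points; real points
    outside [a, b] escape monotonically to infinity under g.

    If g - a and g - b have only real roots, these lie in [a, b]. Let p be the
    point of [a, b] nearest to z. Then |z - x|^2 >= |p - x|^2 + |z - p|^2 for x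
    in [a, b], so factoring g - t yields
    |g(z) - t|^2 >= (1 + |z - p|^2 / (b - a)^2)^deg(g) * |g(p) - t|^2
    for t = a and t = b. As g(p) is real, it cannot be strictly closer than
    g(z) to both a and b when g(z) is in [a, b]; so the preimage of [a, b] under
    g is contained in [a, b]. The same estimate then holds for all iterates of
    g, whose degrees grow, and shows that they tend to infinity locally
    uniformly off [a, b]: the Julia set is contained in [a, b].

    Conversely, if g(z) = b, then by openness of g some points near z are
    mapped to real points slightly larger than b, which escape, whereas z is
    preperiodic: z is in the Julia set, hence real. The same holds for a, and
    the first part shows that [a, b] is contained in the critical interval. *)

Set Implicit Arguments.
Unset Strict Implicit.
Unset Printing Implicit Defensive.

Import Order.TTheory GRing.Theory Num.Theory.
Import numFieldNormedType.Exports.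

Local Open Scope classical_set_scope.
Local Open Scope ring_scope.

Local Notation toC := (real_complex _).
Local Notation mapC := (map_poly (real_complex _)).
Local Notation plane z := (complex.Re z, complex.Im z).

(** * Polynomials with fibres on a real segment *)

Section Algebra.
Variable R : realType.
Implicit Types (a b x y t : R) (z w : R[i]) (f g : {poly R}).

(** Valued in [R] rather than [R[i]], so that all estimates are real inequalities. *)
Definition normsq z : R := complex.Re z ^+ 2 + complex.Im z ^+ 2.

Lemma normsq_ge0 z : 0 <= normsq z.
Proof. by rewrite addr_ge0 ?sqr_ge0. Qed.

Lemma normsqM z w : normsq (z * w) = normsq z * normsq w.
Proof. by case: z w => [x y] [u v]; rewrite /normsq /=; ring. Qed.

Lemma normsq_prod (I : Type) (r : seq I) (F : I -> R[i]) :
  normsq (\prod_(i <- r) F i) = \prod_(i <- r) normsq (F i).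
Proof.
apply: (big_morph normsq normsqM).
by rewrite /normsq /= expr1n expr0n addr0.
Qed.

Lemma normsqR x : normsq (toC x) = x ^+ 2.
Proof. by rewrite /normsq /= expr0n addr0. Qed.

Lemma normsqN z : normsq (- z) = normsq z.
Proof. by case: z => x y; rewrite /normsq /= !sqrrN. Qed.

Lemma normsq_eq0 z : (normsq z == 0) = (z == 0).
Proof.
rewrite paddr_eq0 ?sqr_ge0// !sqrf_eq0.
by case: z => x y; rewrite eq_complex.
Qed.

Lemma normsq_gt0 z : (0 < normsq z) = (z != 0).
Proof. by rewrite lt_def normsq_ge0 normsq_eq0 andbT. Qed.

(** A triangle inequality for squares, from [(x - 2 * u) ^+ 2 >= 0] in each coordinate. *)
Lemma normsq_le_sub z w : normsq z <= 2 * normsq (z - w) + 2 * normsq w.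
Proof.
case: z w => [x y] [u v]; rewrite /normsq /=.
have := sqr_ge0 (x - 2 * u); have := sqr_ge0 (y - 2 * v).
rewrite !sqrrB; nra.
Qed.

Lemma horner_mapC f x : (mapC f).[toC x] = toC f.[x].
Proof. exact: horner_map. Qed.

Definition in_segment a b z :=
  [&& complex.Im z == 0, a <= complex.Re z & complex.Re z <= b].

(** For [a <= b], the point of the segment nearest to a complex [z] is the clamp of its real
    part. *)
Definition clamp a b x := Num.max a (Num.min b x).

Definition segdistsq a b z : R := normsq (z - toC (clamp a b (complex.Re z))).

Lemma clamp_itv a b x : a <= b -> a <= clamp a b x <= b.
Proof.
by move=> ab; rewrite /clamp le_max lexx /= ge_max ab ge_min lexx.
Qed.

Lemma segdistsq_eq0 a b z : a <= b -> (segdistsq a b z == 0) = in_segment a b z.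
Proof.
move=> ab; rewrite normsq_eq0 subr_eq0 /in_segment.
have /andP[h1 h2] := clamp_itv (complex.Re z) ab.
case: z h1 h2 => x y /= h1 h2; rewrite eq_complex /= andbC; case: eqP => //= _.
apply/eqP/andP => [->//|[ax xb]].
by rewrite /clamp min_r// max_r.
Qed.

Lemma segdistsq_gt0 a b z :
  a <= b -> (0 < segdistsq a b z) = ~~ in_segment a b z.
Proof. by move=> ab; rewrite lt_def normsq_ge0 andbT segdistsq_eq0. Qed.

(* The angle at the nearest point of the segment is obtuse. *)
Lemma segdistsq_obtuse a b z x : a <= x <= b ->
  (clamp a b (complex.Re z) - x) ^+ 2 + segdistsq a b z <= normsq (z - toC x).
Proof.
case: z => u v /andP[ax xb]; rewrite /segdistsq /normsq /= /clamp.
case: (leP b u) => bu; first by rewrite max_r ?(le_trans ax)//; nra.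
case: (leP a u) => au; nra.
Qed.

Lemma in_segmentP a b z :
  reflect (exists2 x, a <= x <= b & z = toC x) (in_segment a b z).
Proof.
apply: (iffP idP) => [|[x xab ->]]; last by rewrite /in_segment eqxx.
case: z => x y /and3P[/= /eqP -> ax xb]; exists x => //.
by rewrite ax xb.
Qed.

Lemma normsq_horner_factored (P : {poly R[i]}) :
  exists2 r : seq R[i], size P = (size r).+1 \/ P = 0 &
   (forall w, w \in r -> root P w) /\
   forall w, normsq P.[w] = normsq (lead_coef P) * \prod_(x <- r) normsq (w - x).
Proof.
have [r Pr] := closed_field_poly_normal P; exists r; last split.
- have [->|P0] := eqVneq P 0; [by right | left].
  by rewrite Pr size_scale ?lead_coef_eq0// size_prod_XsubC.
- move=> w wr; rewrite Pr rootE hornerZ horner_prod (big_rem w)//=.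
  by rewrite hornerXsubC subrr mul0r mulr0.
move=> w; rewrite {1}Pr hornerZ normsqM horner_prod normsq_prod.
by congr (_ * _); apply: eq_bigr => x _; rewrite hornerXsubC.
Qed.

(** With [p] the nearest point and [D] the squared distance, each root [x] gives |z - x|^2 >= |p -
    x|^2 + D >= (1 + D / (b - a)^2) |p - x|^2, because |p - x| <= b - a. Multiply over the roots. *)
Lemma segdist_expansion (P : {poly R[i]}) a b z : a < b ->
  (forall w, root P w -> in_segment a b w) ->
  (1 + segdistsq a b z / (b - a) ^+ 2) ^+ (size P).-1 *
    normsq P.[toC (clamp a b (complex.Re z))] <= normsq P.[z].
Proof.
move=> ab Pseg; have [r sr [rr Pr]] := normsq_horner_factored P.
case: sr => [->|->]; last by rewrite size_poly0 mul1r !horner0.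
rewrite !Pr mulrCA ler_wpM2l ?normsq_ge0// succnK.
elim: r rr {Pr} => [|y r IH] rr; first by rewrite !big_nil mulr1.
rewrite !big_cons /= exprS mulrACA.
rewrite ler_pM ?mulr_ge0 ?prodr_ge0 ?exprn_ge0 ?normsq_ge0//.
- by rewrite addr_ge0// divr_ge0 ?sqr_ge0 ?normsq_ge0.
- by rewrite addr_ge0// divr_ge0 ?sqr_ge0 ?normsq_ge0.
- by move=> i _; apply: normsq_ge0.
- have /Pseg/in_segmentP[x xab ->] := rr y (mem_head _ _).
  apply: le_trans (segdistsq_obtuse z xab); rewrite -rmorphB normsqR.
  rewrite mulrDl mul1r lerD2l -mulrA ler_piMr ?normsq_ge0//.
  rewrite mulrC ler_pdivrMr ?exprn_gt0 ?subr_gt0// mul1r.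
  have /andP[c1 c2] := clamp_itv (complex.Re z) (ltW ab).
  move: xab c1 c2 => /andP[]; nra.
- by apply: IH => w wr; apply: rr; rewrite inE wr orbT.
Qed.

Lemma size_mapC_subC g t : (1 < size g)%N ->
  size (mapC g - (toC t)%:P) = size g.
Proof.
move=> sg; rewrite size_polyDl size_map_poly// size_polyN.
by rewrite (leq_ltn_trans (size_polyC_leq1 _)).
Qed.

Definition fibre_in_segment g a b t :=
  forall w, (mapC g).[w] = toC t -> in_segment a b w.

Lemma fibre_expansion g a b t z : a < b -> (1 < size g)%N ->
  fibre_in_segment g a b t ->
  (1 + segdistsq a b z / (b - a) ^+ 2) ^+ (size g).-1 *
    (g.[clamp a b (complex.Re z)] - t) ^+ 2 <= normsq ((mapC g).[z] - toC t).
Proof.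
move=> ab sg gt; rewrite -(size_mapC_subC t sg).
have E w : (mapC g - (toC t)%:P).[w] = (mapC g).[w] - toC t.
  by rewrite hornerD hornerN hornerC.
have := @segdist_expansion (mapC g - (toC t)%:P) a b z ab.
rewrite !E horner_mapC -rmorphB normsqR; apply.
by move=> w; rewrite rootE E subr_eq0 => /eqP/gt.
Qed.

Lemma segment_preimage g a b z : a < b -> (1 < size g)%N ->
  fibre_in_segment g a b a -> fibre_in_segment g a b b ->
  in_segment a b (mapC g).[z] -> in_segment a b z.
Proof.
move=> ab sg ga gb /in_segmentP[s sab gz].
have [/eqP sa|nsa] := boolP (s == a); first by apply: ga; rewrite gz sa.
have [/eqP sb|nsb] := boolP (s == b); first by apply: gb; rewrite gz sb.
rewrite -[in_segment _ _ _]negbK -segdistsq_gt0 ?ltW//; apply/negP => D0.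
have := fibre_expansion z ab sg gb; have := fibre_expansion z ab sg ga.
rewrite gz -!rmorphB !normsqR.
set c := _ ^+ (size g).-1; set p := g.[_].
have c1 : 1 < c.
  rewrite exprn_egt1 ?ltrDl ?divr_gt0 ?exprn_gt0 ?subr_gt0//.
  by case: (size g) sg => [|[]].
move: sab nsa nsb => /andP[as_ sb].
rewrite !neq_lt ltNge as_ (ltNge b) sb /= orbF => {}as_ {}sb.
have as2 : 0 < (s - a) ^+ 2 by rewrite exprn_gt0 ?subr_gt0.
have bs2 : 0 < (s - b) ^+ 2 by rewrite -sqrrN opprB exprn_gt0 ?subr_gt0.
(* If [s <= p], then [p] is at least as far from [a] as [s] is; if [p < s], it is at least as far
   from [b]. Either contradicts [1 < c]. *)
move=> h1 h2; case: (leP s p) => sp; last first.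
  have : (s - b) ^+ 2 <= (p - b) ^+ 2 by nra.
  nra.
have : (s - a) ^+ 2 <= (p - a) ^+ 2 by nra.
nra.
Qed.

(** Iterates as polynomials, so that [fibre_expansion] applies to them. *)
Definition comp_iter g n : {poly R} := iter n (fun p => p \Po g) 'X.

Lemma horner_mapC_comp f g z : (mapC (f \Po g)).[z] = (mapC f).[(mapC g).[z]].
Proof. by rewrite map_comp_poly horner_comp. Qed.

Lemma horner_comp_iter g n z :
  (mapC (comp_iter g n)).[z] = iter n (fun w => (mapC g).[w]) z.
Proof.
elim: n z => [|n IH] z; first by rewrite map_polyX hornerX.
by rewrite iterSr /= horner_mapC_comp IH.
Qed.

Lemma size_comp_iter g n : (size (comp_iter g n)).-1 = ((size g).-1 ^ n)%N.
Proof.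
elim: n => [|n IH]; first by rewrite size_polyX.
by rewrite /= size_comp_poly IH expnSr.
Qed.

(** Bernoulli's inequality together with [n <= e ^ n]; linear growth in [n] suffices for the
    escape. *)
Lemma bernoulli_expn (u : R) e n : 0 <= u -> (1 < e)%N ->
  1 + n%:R * u <= (1 + u) ^+ (e ^ n).
Proof.
move=> u0 e1; apply: (@le_trans _ _ ((1 + u) ^+ n)).
  elim: n => [|n IH]; first by rewrite mul0r addr0.
  have u1 : 0 <= 1 + u by rewrite addr_ge0.
  rewrite exprS -natr1; apply: le_trans (ler_wpM2l u1 IH).
  have : 0 <= n%:R * u * u by rewrite !mulr_ge0.
  nra.
by rewrite ler_weXn2l ?lerDl// ltnW// ltn_expl.
Qed.

(** Pulling the segment back step by step keeps the fibres of every iterate over [a] and [b] inside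
    it, so [fibre_expansion] holds for the iterate. The 8 combines the 4 of the half-length squared
    with the 2 of [normsq_le_sub]. *)
Lemma comp_iter_escape g a b n z : a < b -> (2 < size g)%N ->
  fibre_in_segment g a b a -> fibre_in_segment g a b b ->
  (1 + n%:R * (segdistsq a b z / (b - a) ^+ 2)) * ((b - a) ^+ 2 / 8)
    - (a ^+ 2 + b ^+ 2) <= normsq (mapC (comp_iter g n)).[z].
Proof.
move=> ab sg ga gb.
have back w : in_segment a b (mapC (comp_iter g n)).[w] -> in_segment a b w.
  rewrite horner_comp_iter; elim: n => [//|n IH] /=.
  by move/(segment_preimage ab (ltnW sg) ga gb)/IH.
have sG : (1 < size (comp_iter g n))%N.
  by rewrite -ltn_predRL size_comp_iter expn_gt0 ltn_predRL (ltn_trans _ sg).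
have end_fibre t : a <= t <= b -> fibre_in_segment (comp_iter g n) a b t.
  by move=> tab w wt; apply: back; apply/in_segmentP; exists t.
set c := 1 + _ * _; pose p := (comp_iter g n).[clamp a b (complex.Re z)].
have bound t : a <= t <= b ->
    c * (p - t) ^+ 2 <= 2 * normsq (mapC (comp_iter g n)).[z] + 2 * t ^+ 2.
  move=> tab; have := fibre_expansion z ab sG (end_fibre t tab).
  rewrite size_comp_iter -/p => H.
  have := normsq_le_sub ((mapC (comp_iter g n)).[z] - toC t) (- toC t).
  rewrite opprK subrK normsqN normsqR => H'.
  apply: le_trans H'; apply: le_trans H; rewrite ler_wpM2r ?sqr_ge0//.
  apply: bernoulli_expn; first by rewrite divr_ge0 ?sqr_ge0 ?normsq_ge0.
  by case: (size g) sg => [|[|[]]].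
have c0 : 0 <= c by rewrite addr_ge0// mulr_ge0// divr_ge0 ?sqr_ge0 ?normsq_ge0.
have ha : a <= a <= b by rewrite lexx ltW.
have hb : a <= b <= b by rewrite lexx ltW.
have := sqr_ge0 a; have := sqr_ge0 b; have := bound a ha; have := bound b hb.
(* The endpoint farther from [p] is at distance at least [(b - a) / 2]. *)
case: (leP (a + b) (2 * p)) => hp.
  have : (b - a) ^+ 2 / 4 <= (p - a) ^+ 2 by nra.
  nra.
have : (b - a) ^+ 2 / 4 <= (p - b) ^+ 2 by nra.
nra.
Qed.

End Algebra.

(** * The critical interval and the extremal fixed points *)

(** Linear factors are peeled off by induction on the size. Over the reals, [q] carries the nonreal
    roots. *)
Lemma split_roots (F : fieldType) (p : {poly F}) : p != 0 ->
  exists s (q : {poly F}),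
    p = (\prod_(x <- s) ('X - x%:P)) * q /\ forall x, ~~ root q x.
Proof.
have [n] := ubnP (size p); elim: n p => // n IH p sp p0.
have [[x /factor_theorem[q pq]]|nr] := pselect (exists x, root p x); last first.
  exists [::], p; rewrite big_nil mul1r; split=> // x.
  by apply/negP => px; apply: nr; exists x.
have q0 : q != 0 by apply: contraNneq p0 => q0; rewrite pq q0 mul0r.
have [|s [r [qr rr]]] := IH q _ q0.
  by move: sp; rewrite pq size_Mmonic ?monicXsubC// size_XsubC addn2.
by exists (x :: s), r; split=> //; rewrite big_cons pq {1}qr mulrC mulrA.
Qed.

Lemma mup_prod_XsubC (F : fieldType) (s : seq F) (x : F) :
  mup x (\prod_(y <- s) ('X - y%:P)) = count_mem x s.
Proof.
elim: s => [|y s IH]; first by rewrite big_nil mupNroot ?root1.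
rewrite big_cons mupM ?polyXsubC_eq0 ?monic_neq0 ?monic_prod_XsubC// IH.
by rewrite -['X - _]expr1 mup_XsubCX /=; case: eqP.
Qed.

Lemma max_seq d (T : orderType d) (s : seq T) : s != [::] ->
  exists2 m, m \in s & forall x, x \in s -> (x <= m)%O.
Proof.
elim: s => // y [|z s] IH _.
  by exists y; rewrite ?mem_head// => x; rewrite inE => /eqP ->.
have [//|m ms mx] := IH _; have [ym|my] := leP y m.
  exists m => [|x]; first by rewrite inE ms orbT.
  by rewrite inE => /orP[/eqP ->//|/mx].
exists y => [|x]; first exact: mem_head.
by rewrite inE => /orP[/eqP ->//|/mx xm]; exact: le_trans xm (ltW my).
Qed.

Section RealPolynomials.
Variable R : realType.
Implicit Types (a b x y t : R) (z w : R[i]) (f g : {poly R}).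

(** Split [g - t] into real linear factors and a cofactor [q] without real roots. The multiplicities
    add up to [size s], so [t] is in the critical interval exactly when [q] is constant, that is,
    when [q] has no complex root. *)
Lemma mem_critical_interval g t : (1 < size g)%N ->
  critical_interval g t <->
  forall w, (mapC g).[w] = toC t -> complex.Im w = 0.
Proof.
move=> sg; pose p := g - t%:P.
have sp : size p = size g.
  by rewrite size_polyDl// size_polyN (leq_ltn_trans (size_polyC_leq1 _)).
have p0 : p != 0 by rewrite -size_poly_gt0 sp (ltn_trans _ sg).
have [s [q [pq nq]]] := split_roots p0.
have q0 : q != 0 by apply: contraNneq p0 => q0; rewrite pq q0 mulr0.
have rp x : root p x = (x \in s).
  by rewrite pq rootM root_prod_XsubC (negbTE (nq x)) orbF.
have mp x : mup x p = count_mem x s by rewrite pq mupMl// mup_prod_XsubC.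
have ssq : size g = (size s + size q)%N.
  by rewrite -sp pq size_monicM ?monic_prod_XsubC// size_prod_XsubC.
have rootE_p w : root (mapC p) w <-> (mapC g).[w] = toC t.
  rewrite rootE /p rmorphB /= map_polyC hornerD hornerN hornerC subr_eq0.
  by split=> [/eqP|/eqP].
have countE :
    (\big[addn/0%N]_(x \in [set x : R | g.[x] = t]) mup x p)%N = size s.
  have -> : [set x | g.[x] = t] = [set` undup s].
    apply/seteqP; split=> x /=; rewrite mem_undup -rp;
      rewrite rootE /p hornerD hornerN hornerC subr_eq0.
      by move=> ->.
    by move/eqP.
  rewrite -fsbig_seq ?undup_uniq//.
  (* Each multiplicity is written as a sum of that many ones, so that the sum over distinct roots
     becomes a sum over [s]. *)
  transitivity (\sum_(x <- undup s) iterop (count_mem x s) addn 1 0)%N.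
    apply: eq_bigr => x _; rewrite mp.
    by elim: (count_mem x s) => // -[|n] //= <-.
  by rewrite big_undup_iterop_count sum1_size.
rewrite /critical_interval /= countE ssq; split=> [E|H].
  have /size_poly1P[c c0 qc] : size q == 1%N.
    move: E q0; rewrite -size_poly_gt0; case: (size q) => // k.
    by rewrite addnS /= -{1}[size s]addn0 => /addnI <-.
  move=> w /rootE_p; rewrite pq qc rmorphM /= rootM map_polyC rootC.
  rewrite fmorph_eq0 (negbTE c0) orbF.
  rewrite rmorph_prod /= rootE horner_prod prodf_seq_eq0 => /hasP[x _].
  by rewrite rmorphB /= map_polyX map_polyC hornerXsubC subr_eq0 => /eqP ->.
suff -> : size q = 1%N by rewrite addn1.
apply/eqP; rewrite -(size_map_poly (real_complex R)).
apply/negPn/negP => /closed_rootP[w qw].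
have wr : complex.Im w = 0.
  by apply: H; apply/rootE_p; rewrite pq rmorphM rootM qw orbT.
have wE : w = toC (complex.Re w) by case: w wr {qw} => u v /= ->.
by move: qw; rewrite wE fmorph_root (negbTE (nq _)).
Qed.

Lemma lead_coef_sub_X g : (2 < size g)%N -> lead_coef (g - 'X) = lead_coef g.
Proof. by move=> sg; rewrite lead_coefDl// size_polyN size_polyX. Qed.

Lemma size_sub_X g : (2 < size g)%N -> size (g - 'X) = size g.
Proof. by move=> sg; rewrite size_polyDl// size_polyN size_polyX. Qed.

Lemma root_sub_X g x : root (g - 'X) x = (g.[x] == x).
Proof. by rewrite rootE hornerD hornerN hornerX subr_eq0. Qed.

(** [g - 'X] has even size, that is, odd degree, hence a real root. *)
Lemma Fix_neq0 g : ~~ odd (size g) -> (2 < size g)%N -> Fix g !=set0.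
Proof.
move=> og sg; have p0 : g - 'X != 0.
  by rewrite -size_poly_gt0 size_sub_X// (ltn_trans _ sg).
have [|x] := @odd_poly_root _ (g - 'X); first by rewrite size_sub_X.
by rewrite root_sub_X => /eqP; exists x.
Qed.

(** Beyond its largest root, [g - 'X] has the sign of its leading coefficient. *)
Lemma last_fixpoint g : (2 < size g)%N -> 0 < lead_coef g -> Fix g !=set0 ->
  exists2 b, Fix g b & forall x, b < x -> x < g.[x].
Proof.
move=> sg lg [c gc]; pose p := g - 'X.
have p0 : p != 0 by rewrite -size_poly_gt0 size_sub_X// (ltn_trans _ sg).
have rE x : root p x = (x \in rootsR p) by rewrite -(roots_on_rootsR p0).
have [|b bp bm] := @max_seq _ _ (rootsR p).
  have : c \in rootsR p by rewrite -rE root_sub_X gc.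
  by case: rootsR.
exists b; first by apply/eqP; rewrite -root_sub_X rE.
move=> x bx; rewrite -subr_gt0 -sgr_cp0.
have -> : g.[x] - x = p.[x] by rewrite /p !hornerE.
rewrite (@sgp_pinftyP _ x p).
- by rewrite /sgp_pinfty lead_coef_sub_X// gtr0_sg.
- move=> y; rewrite in_itv /= andbT => xy; rewrite rE; apply/negP => /bm yb.
  by move: (le_lt_trans (le_trans xy yb) bx); rewrite ltxx.
- by rewrite in_itv /= lexx.
Qed.

(** Conjugation by x -> -x reduces this to [last_fixpoint]; the odd degree keeps the leading
    coefficient positive. *)
Lemma first_fixpoint g : ~~ odd (size g) -> (2 < size g)%N ->
  0 < lead_coef g -> Fix g !=set0 ->
  exists2 a, Fix g a & forall x, x < a -> g.[x] < x.
Proof.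
move=> og sg lg [c gc].
pose h := - (g \Po (- 'X)).
have hE x : h.[x] = - g.[- x] by rewrite /h hornerN horner_comp hornerN hornerX.
have sX : size (- 'X : {poly R}) = 2 by rewrite size_polyN size_polyX.
have sh : size h = size g by rewrite size_polyN size_comp_poly2.
have lh : 0 < lead_coef h.
  rewrite lead_coefN lead_coef_comp ?sX// lead_coefN lead_coefX -signr_odd.
  have -> : odd (size g).-1 by case: (size g) og sg => //= n; rewrite negbK.
  by rewrite expr1 mulrN1 opprK.
have hc : Fix h !=set0 by exists (- c); rewrite /Fix /= hE opprK gc.
have [|b hb H] := last_fixpoint _ lh hc; first by rewrite sh.
exists (- b); first by rewrite /Fix /= -[g.[_]]opprK -hE hb.
move=> x xb; have := H (- x); rewrite ltrNr xb => /(_ isT).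
by rewrite hE opprK ltrN2.
Qed.

End RealPolynomials.

(** * Equicontinuity on the Riemann sphere *)

Section IteratedMaps.
Variables (X : puniformType) (F : X -> X).

(** As [U] is open, the subspace neighbourhoods of its points generate full neighbourhoods. *)
Lemma fatou_near (x : X) (E : set (X * X)) : Defs.fatou F x -> entourage E ->
  \forall y \near x, forall n, E (iter n F x, iter n F y).
Proof.
move=> [U [oU eU] Ux] entE; have := eU x E entE.
rewrite /prop_near1 ![nbhs (_ : subspace _)]/nbhs/= -!nbhs_subspace_in//.
rewrite /within/= => H.
have nU : nbhs (x : X) U by exact: open_nbhs_nbhs.
by apply: filterS2 nU H => y Uy /(_ Uy) H n; apply: H.
Qed.

Lemma continuous_iter n : continuous F -> continuous (iter n F).
Proof.
move=> cF; elim: n => [|n IH] x; first exact: cvg_id.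
by apply: (@continuous_comp _ _ _ (iter n F) F); [exact: IH | exact: cF].
Qed.

(** For [n >= N] both orbits are close to [c], hence to each other; the finitely many earlier
    iterates are handled by continuity. *)
Lemma attracted_near (x c : X) (E : set (X * X)) : continuous F ->
  (forall W : set X, nbhs c W ->
    exists N, \forall y \near x, forall n, (N <= n)%N -> W (iter n F y)) ->
  entourage E -> \forall y \near x, forall n, E (iter n F x, iter n F y).
Proof.
move=> cF att entE; have entE' := entourage_split_ent entE.
pose W := [set y | split_ent E (c, y) /\ split_ent E (y, c)].
have nW : nbhs c W.
  have h1 : nbhs c [set y | split_ent E (c, y)].
    by rewrite -nbhs_entourageE; exists (split_ent E) => // y /set_mem.
  have h2 : nbhs c [set y | split_ent E (y, c)].
    rewrite -nbhs_entourageE; exists ((split_ent E)^-1)%relation.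
      exact: entourage_inv.
    by move=> y /set_mem.
  by apply: filterS2 h1 h2.
have [N HN] := att W nW.
have HNx := nbhs_singleton HN.
have small : \forall y \near x, forall n,
    (n < N)%N -> E (iter n F x, iter n F y).
  elim: {HN HNx} N => [|N IH]; first by apply: filterE.
  have := continuous_iter (n := N) cF (x := x) => /cvg_entourageP /(_ E entE).
  rewrite near_simpl => H; apply: filterS2 IH H => y h1 h2 n.
  by rewrite ltnS leq_eqVlt => /orP[/eqP -> //|/h1].
apply: filterS2 HN small => y h1 h2 n; have [/h2//|Nn] := ltnP n N.
have [_ xc] := HNx n Nn; have [cy _] := h1 n Nn.
exact: entourage_split xc cy.
Qed.

Lemma attracted_equicontinuous (U : set X) (c : X) : continuous F ->
  (forall x, U x -> forall W : set X, nbhs c W ->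
    exists N, \forall y \near x, forall n, (N <= n)%N -> W (iter n F y)) ->
  equicontinuous_iter F U.
Proof.
move=> cF att x E entE; have [Ux|nUx] := pselect (U x); last first.
  (* A point outside [U] is isolated in [subspace U]. *)
  rewrite /prop_near1 /nbhs/= -nbhs_subspace_out// => y -> i _.
  exact: entourage_refl.
have := attracted_near cF (att x Ux) entE.
rewrite /prop_near1 ![nbhs (_ : subspace _)]/nbhs/= -!nbhs_subspace_in//.
by rewrite /within /= => H; apply: filterS H => y H _ i _; apply: H.
Qed.

End IteratedMaps.

(** * Neighbourhoods on the Riemann sphere *)

Section RiemannSphere.
Variable R : realType.
Implicit Types (a b x y t : R) (z w : R[i]) (f g : {poly R}).

Lemma nbhs_plane z (A : set (R * R)) : nbhs (plane z) A <->
  exists2 e, 0 < e & forall w, normsq (w - z) < e -> A (plane w).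
Proof.
split=> [/nbhs_ballP[e /= e0 eA]|[e e0 eA]].
  exists (e ^+ 2); first by rewrite exprn_gt0.
  case: z eA => x y eA [u v]; rewrite /normsq /= => H; apply: eA.
  have sq t : t ^+ 2 < e ^+ 2 -> `|t| < e.
    by move=> te; rewrite ltr_norml; apply/andP; split; nra.
  split; rewrite /ball /= distrC; apply: sq.
    by have := sqr_ge0 (v - y); lra.
  by have := sqr_ge0 (u - x); lra.
(* [t ^+ 2 <= |t| < e / 2] as soon as [|t|] is below both 1 and [e / 2]. *)
pose d := Num.min 1 (e / 2).
have d0 : 0 < d by rewrite lt_min ltr01 divr_gt0.
apply/nbhs_ballP; exists d => //= -[u v]; rewrite /ball /= /ball /= => -[h1 h2].
case: z h1 h2 eA => x y /= h1 h2 /(_ (Complex u v)); apply; rewrite /normsq /=.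
have sq t : `|t| < d -> t ^+ 2 < e / 2.
  rewrite lt_min => /andP[t1 t2]; rewrite -real_normK ?num_real// expr2.
  by have := normr_ge0 t; nra.
have := sq _ h1; have := sq _ h2; rewrite -!(sqrrN (_ - _)) !opprB; lra.
Qed.

Lemma nbhs_P1E (p : P1 R) (V : set (P1 R)) :
  nbhs p V <-> exists2 B, nbhs (stereo p) B & forall q, B (stereo q) -> V q.
Proof.
split=> [[U [[B oB <-] Bp sV]]|[B nB BV]].
  by exists B => //; exact: open_nbhs_nbhs.
have H : nbhs p (@stereo R @^-1` B) by exact: initial_continuous.
by apply: filterS H => q; exact: BV.
Qed.

Lemma cvg_pair2 (T : Type) (G : set_system T) (U V : topologicalType)
    (h : T -> U) (k : T -> V) (u : U) (v : V) : Filter G ->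
  h @ G --> u -> k @ G --> v -> (h t, k t) @[t --> G] --> (u, v).
Proof. by move=> FG; exact: cvg_pair. Qed.

(** [stereo] is continuous on the plane, and off the pole it has a continuous inverse. *)
Lemma nbhs_Some z (V : set (P1 R)) : nbhs (Some z : P1 R) V <->
  \forall q \near plane z, V (Some (Complex q.1 q.2)).
Proof.
rewrite nbhs_P1E; split=> [[B nB BV]|nV].
  suff : stereo (Some (Complex q.1 q.2)) @[q --> plane z] --> stereo (Some z).
    move=> /(_ B nB) nB'.
    have {}nB' : nbhs (plane z)
        [set q | B (stereo (Some (Complex q.1 q.2)))] by [].
    by apply: filterS nB' => q; exact: BV.
  case: z nB => x y _; rewrite /stereo /=.
  have c1 : q.1 @[q --> (x, y)] --> x by exact: cvg_fst.
  have c2 : q.2 @[q --> (x, y)] --> y by exact: cvg_snd.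
  have cs : (q.1 ^+ 2 + q.2 ^+ 2) @[q --> (x, y)] --> x ^+ 2 + y ^+ 2.
    by apply: cvgD; apply: cvgM.
  have ci : (1 + (q.1 ^+ 2 + q.2 ^+ 2))^-1 @[q --> (x, y)]
      --> (1 + (x ^+ 2 + y ^+ 2))^-1.
    apply: cvgV; last by apply: cvgD => //; exact: cvg_cst.
    by rewrite gt_eqF// ltr_pwDl// addr_ge0 ?sqr_ge0.
  apply: cvg_pair2; first apply: cvg_pair2.
  - by apply: cvgM => //; apply: cvgM => //; exact: cvg_cst.
  - by apply: cvgM => //; apply: cvgM => //; exact: cvg_cst.
  - by apply: cvgM => //; apply: cvgB => //; exact: cvg_cst.
pose V' := [set q : R * R | V (Some (Complex q.1 q.2))].
have s1 w : 1 + (complex.Re w ^+ 2 + complex.Im w ^+ 2) != 0.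
  by rewrite gt_eqF// ltr_pwDl// addr_ge0 ?sqr_ge0.
have sZ w : 1 - (stereo (Some w)).2 =
    2 / (1 + (complex.Re w ^+ 2 + complex.Im w ^+ 2)).
  by rewrite /stereo /=; have := s1 w => h; field.
(* Stereographic projection from the pole (0, 0, 1), the image of infinity. *)
pose proj (u : R * R * R) := (u.1.1 / (1 - u.2), u.1.2 / (1 - u.2)).
have projK w : proj (stereo (Some w)) = plane w.
  rewrite /proj sZ /stereo /=.
  by have h := s1 w; congr (_, _); field; rewrite h.
exists [set u | u.2 != 1 /\ V' (proj u)]; last first.
  move=> [w|] [/= h]; last by rewrite eqxx in h.
  by have := projK w; rewrite /stereo /= => ->; case: w {h}.
have Z1 : (stereo (Some z)).2 != 1.
  by rewrite eq_sym -subr_eq0 sZ mulf_neq0 ?invr_eq0 ?s1// pnatr_eq0.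
set u0 := stereo (Some z) in Z1 *.
have c11 : u.1.1 @[u --> u0] --> u0.1.1.
  by apply: (@cvg_comp _ _ _ (@fst (R * R)%type R) fst _ (nbhs u0.1));
    exact: cvg_fst.
have c12 : u.1.2 @[u --> u0] --> u0.1.2.
  apply: (@cvg_comp _ _ _ (@fst (R * R)%type R) snd _ (nbhs u0.1)).
    exact: cvg_fst.
  exact: cvg_snd.
have c2 : u.2 @[u --> u0] --> u0.2 by exact: cvg_snd.
have ci : (1 - u.2)^-1 @[u --> u0] --> (1 - u0.2)^-1.
  apply: cvgV; first by rewrite subr_eq0 eq_sym.
  by apply: cvgB => //; exact: cvg_cst.
have cp : proj u @[u --> u0] --> proj u0 by apply: cvg_pair2; apply: cvgM.
have h1 : nbhs u0 [set u : R * R * R | u.2 != 1].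
  apply: (c2 [set t | t != 1]); apply: open_nbhs_nbhs; split; last exact: Z1.
  exact: open_neq.
have h2 : nbhs u0 [set u | V' (proj u)] by apply: (cp V'); rewrite projK.
exact: filterI h1 h2.
Qed.

Lemma nbhs_Some_normsq z (V : set (P1 R)) : nbhs (Some z : P1 R) V <->
  exists2 e, 0 < e & forall w, normsq (w - z) < e -> V (Some w).
Proof.
rewrite nbhs_Some [X in X <-> _]nbhs_plane; split=> -[e e0 eV]; exists e => //.
  by move=> [u v] /eV.
by move=> [u v] /eV.
Qed.

Lemma nbhs_None (V : set (P1 R)) : nbhs (None : P1 R) V <->
  V None /\ exists M, forall w, M < normsq w -> V (Some w).
Proof.
split=> [nV|[VN [M MV]]].
  split; first exact: nbhs_singleton nV.
  move/nbhs_P1E: nV => [B /nbhs_ballP[e /= e0 eB] BV].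
  (* The term [4 / e ^+ 2] makes the horizontal coordinates smaller than [e], and [2 / e] brings the
     height within [e] of 1. *)
  exists (4 / e ^+ 2 + 2 / e) => w wM; apply/BV/eB.
  have : 4 / e ^+ 2 < normsq w.
    by apply: le_lt_trans wM; rewrite lerDl divr_ge0 ?ltW.
  have : 2 / e < normsq w.
    by apply: le_lt_trans wM; rewrite lerDr divr_ge0 ?sqr_ge0.
  rewrite !ltr_pdivrMr ?exprn_gt0//.
  case: w {wM} => x y; rewrite /normsq /stereo /=; set s := x ^+ 2 + y ^+ 2.
  move=> h1 h2.
  have s0 : 0 < 1 + s by rewrite ltr_pwDl// addr_ge0 ?sqr_ge0.
  have bnd t : t ^+ 2 <= s -> `|0 - 2 * t / (1 + s)| < e.
    move=> ts; rewrite sub0r normrN ltr_norml ltr_pdivrMr// ltr_pdivlMr//.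
    by apply/andP; split; nra.
  split; first split; rewrite /ball /=.
  - by apply: bnd; rewrite lerDl sqr_ge0.
  - by apply: bnd; rewrite lerDr sqr_ge0.
  have -> : 1 - (s - 1) / (1 + s) = 2 / (1 + s).
    by field; rewrite gt_eqF.
  rewrite ger0_norm ?divr_ge0 ?ltW// ltr_pdivrMr//; nra.
apply/nbhs_P1E; pose m := Num.max 0 M.
have m0 : 0 <= m by rewrite le_max lexx.
(* A cap around the pole: the point over [w] has height [1 - 2 / (1 + normsq w)]. *)
exists [set u | 1 - 2 / (1 + m) < u.2].
  have -> : [set u : R * R * R | 1 - 2 / (1 + m) < u.2] =
      snd @^-1` [set t | 1 - 2 / (1 + m) < t] by [].
  apply: (@cvg_snd _ _ (nbhs _) (nbhs (1 : R))).
  apply: open_nbhs_nbhs; split; first exact: open_gt.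
  by rewrite /= gtrDl oppr_lt0 divr_gt0// ltr_pwDl.
move=> [w|//] /= H; apply: MV; apply: (@le_lt_trans _ _ m).
  by rewrite le_max lexx orbT.
move: H; rewrite -/(normsq w); have := normsq_ge0 w; set s := normsq w => s0.
have p1 : 0 < 1 + s by rewrite ltr_pwDl.
have p2 : 0 < 1 + m by rewrite ltr_pwDl.
have -> : (s - 1) / (1 + s) = 1 - 2 / (1 + s).
  by field; rewrite gt_eqF.
rewrite ltrD2l ltrN2 ltr_pdivrMr// mulrAC ltr_pdivlMr// ltr_pM2l//.
by rewrite ltrD2l.
Qed.

End RiemannSphere.

(** * Escape and instability *)

Section Dynamics.
Variable R : realType.
Implicit Types (a b x y t : R) (z w : R[i]) (f g : {poly R}).

Lemma cvg_horner_plane (P : {poly R[i]}) z :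
  (complex.Re P.[Complex q.1 q.2] @[q --> plane z] --> complex.Re P.[z]) /\
  (complex.Im P.[Complex q.1 q.2] @[q --> plane z] --> complex.Im P.[z]).
Proof.
have c1 : q.1 @[q --> plane z] --> complex.Re z by exact: cvg_fst.
have c2 : q.2 @[q --> plane z] --> complex.Im z by exact: cvg_snd.
elim/poly_ind: P => [|P c [IHr IHi]].
  by rewrite horner0; split; under eq_fun do rewrite horner0; exact: cvg_cst.
have E w : (P * 'X + c%:P).[w] =
    Complex (complex.Re P.[w] * complex.Re w - complex.Im P.[w] * complex.Im w
              + complex.Re c)
            (complex.Re P.[w] * complex.Im w + complex.Im P.[w] * complex.Re w
              + complex.Im c).
  by rewrite !hornerE; move: P.[w] => [u v]; case: w => ? ?; case: c.
rewrite E /=; split; under eq_fun do rewrite E /=.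
  by apply: cvgD; [apply: cvgB; exact: cvgM | exact: cvg_cst].
by apply: cvgD; [apply: cvgD; exact: cvgM | exact: cvg_cst].
Qed.

Lemma normsq_sub_large (r : seq R[i]) (K : R) :
  exists M, forall w, M < normsq w -> forall v, v \in r -> K <= normsq (w - v).
Proof.
elim: r => [|y r [M HM]]; first by exists 0.
exists (Num.max M (2 * K + 2 * normsq y)) => w.
rewrite gt_max => /andP[wM wy] v.
rewrite inE => /orP[/eqP ->|]; last exact: HM.
by have := normsq_le_sub w y; lra.
Qed.

Lemma horner_large (P : {poly R[i]}) (K : R) : (1 < size P)%N ->
  exists M, forall w, M < normsq w -> K < normsq P.[w].
Proof.
move=> sP; have [r [sr|P0] [_ Pr]] := normsq_horner_factored P; last first.
  by rewrite P0 size_poly0 in sP.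
have A0 : 0 < normsq (lead_coef P).
  by rewrite normsq_gt0 lead_coef_eq0 -size_poly_gt0 (ltn_trans _ sP).
set A := normsq _ in A0 Pr.
(* Once every factor is at least [K' >= 1], so is their nonempty product, and
   [A * K' = A + |K| > K]. *)
pose K' := 1 + `|K| / A; have K'1 : 1 <= K' by rewrite lerDl divr_ge0// ltW.
have [M HM] := normsq_sub_large r K'; exists M => w /HM wM; rewrite Pr.
have : K' <= \prod_(x <- r) normsq (w - x).
  case: r sr wM {Pr HM} => [sr|y r _ wM]; first by rewrite sr in sP.
  rewrite big_cons -[leLHS]mulr1 ler_pM ?(le_trans _ K'1) ?wM ?mem_head//.
  rewrite big_seq; elim/big_ind: _ => // [u v u1 v1|x xr].
    by rewrite -[leLHS]mulr1 ler_pM.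
  by rewrite (le_trans K'1)// wM// inE xr orbT.
move=> H; apply: (@lt_le_trans _ _ (A * K')); last by rewrite ler_pM2l.
rewrite mulrDr mulr1 mulrCA divff ?gt_eqF// mulr1.
by have := ler_norm K; lra.
Qed.

Lemma continuous_P1_map f : (1 < size f)%N -> continuous (@P1_map R f).
Proof.
move=> sf [z|] V /=.
  move/nbhs_Some => nV; apply/nbhs_Some.
  have [cr ci] := cvg_horner_plane (mapC f) z.
  have H : \forall q \near plane z, V (Some (Complex
      (complex.Re (mapC f).[Complex q.1 q.2])
      (complex.Im (mapC f).[Complex q.1 q.2]))).
    exact: cvg_pair2 (nbhs_filter _) cr ci _ nV.
  by apply: filterS H => q /=; case: (_.[_]).
move/nbhs_None => [VN [M MV]]; apply/nbhs_None; split=> //.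
have [|M' HM'] := @horner_large (mapC f) M; first by rewrite size_map_poly.
by exists M' => w /HM' /MV.
Qed.

Lemma iter_P1_map_None f n : iter n (@P1_map R f) None = None.
Proof. by elim: n => //= n ->. Qed.

Lemma iter_P1_map_double f n z :
  iter n.*2 (@P1_map R f) (Some z) =
  Some (iter n (fun w => (mapC (f \Po f)).[w]) z).
Proof. by elim: n => // n IH; rewrite doubleS /= IH /= horner_mapC_comp. Qed.

Definition off_segment a b : set (P1 R) :=
  [set p | if p is Some w then ~~ in_segment a b w else true].

(** Provides the uniform distance to the segment that makes the escape locally uniform, at infinity
    too. *)
Lemma off_segment_near a b (p : P1 R) : a <= b -> off_segment a b p ->
  exists2 k, 0 < k &
    \forall q \near p, if q is Some w then k <= segdistsq a b w else true.
Proof.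
move=> ab; case: p => [z|_].
  rewrite /off_segment /= -segdistsq_gt0// => D0.
  (* If D is the squared distance of [z], then D <= 2 |w - z|^2 + 2 [segdistsq a b w]; with |w -
     z|^2 < D / 4 this leaves at least D / 4. *)
  exists (segdistsq a b z / 4); first by rewrite divr_gt0.
  apply/nbhs_Some_normsq; exists (segdistsq a b z / 4).
    by rewrite divr_gt0.
  move=> w wz; set q := toC (clamp a b (complex.Re w)).
  have h1 : segdistsq a b z <= normsq (z - q).
    apply: le_trans (segdistsq_obtuse z (clamp_itv (complex.Re w) ab)).
    by rewrite lerDr sqr_ge0.
  have := normsq_le_sub (z - q) (w - q).
  have -> : z - q - (w - q) = - (w - z) by ring.
  rewrite normsqN -[normsq (w - q)]/(segdistsq a b w); lra.
exists 1 => //; apply/nbhs_None; split=> //.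
exists (2 + 2 * (a ^+ 2 + b ^+ 2)) => w wM.
have := normsq_le_sub w (toC (clamp a b (complex.Re w))).
rewrite normsqR -[normsq (w - _)]/(segdistsq a b w).
have /andP[] := clamp_itv (complex.Re w) ab; set c := clamp _ _ _ => ac cb.
have : c ^+ 2 <= a ^+ 2 + b ^+ 2.
  by have [c0|c0] := leP 0 c; nra.
lra.
Qed.

(** Infinity attracts the complement of the segment locally uniformly, by [comp_iter_escape]. *)
Lemma off_segment_fatou f a b : a < b ->
  (1 < size f)%N -> (2 < size (f \Po f))%N ->
  fibre_in_segment (f \Po f) a b a -> fibre_in_segment (f \Po f) a b b ->
  off_segment a b `<=` Defs.fatou (@P1_map R f).
Proof.
move=> ab sf sg ga gb q Uq; exists (off_segment a b) => //; split=> {q Uq} /=.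
  rewrite openE => p /(off_segment_near (ltW ab)) [k k0 pk]; rewrite /interior.
  apply: filterS pk => -[w|//] kw.
  rewrite /off_segment /= -segdistsq_gt0 ?ltW//.
  exact: lt_le_trans k0 kw.
have cF := @continuous_P1_map f sf.
apply: (@attracted_equicontinuous _ _ _ (None : P1 R)) => // p Up W nW.
(* The even iterates of [f] are the iterates of [f \Po f]; the preimage of [W] takes care of the odd
   ones. *)
have /nbhs_None[[_ _] [M WM]] : nbhs (None : P1 R) (W `&` P1_map f @^-1` W).
  by apply: filterI => //; exact: (cF None).
have [k k0 pk] := off_segment_near (ltW ab) Up.
pose B := M + a ^+ 2 + b ^+ 2.
(* Enough steps [m] of [f \Po f] for [m * k / 8] to exceed [B], doubled to count steps of [f]. *)
exists (Num.truncn (B / (k / 8))).+1.*2.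
apply: filterS pk => -[w kw|_ n _]; last first.
  by rewrite iter_P1_map_None; exact: nbhs_singleton nW.
have step m : ((Num.truncn (B / (k / 8))).+1 <= m)%N ->
    (W `&` P1_map f @^-1` W) (Some (iter m (fun w => (mapC (f \Po f)).[w]) w)).
  move=> Nm; apply: WM; rewrite -horner_comp_iter.
  apply: lt_le_trans (comp_iter_escape m w ab sg ga gb).
  have L0 : 0 < (b - a) ^+ 2 by rewrite exprn_gt0// subr_gt0.
  have -> : (1 + m%:R * (segdistsq a b w / (b - a) ^+ 2)) * ((b - a) ^+ 2 / 8) =
     (b - a) ^+ 2 / 8 + m%:R * (segdistsq a b w / 8).
    by field; rewrite gt_eqF// subr_gt0.
  have h : B / (k / 8) < m%:R.
    by apply: (lt_le_trans (truncnS_gt _)); rewrite ler_nat.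
  rewrite ltr_pdivrMr ?divr_gt0// in h.
  have : m%:R * (k / 8) <= m%:R * (segdistsq a b w / 8).
    by rewrite ler_wpM2l// ler_pM2r// invr_gt0.
  by move: h; rewrite /B; lra.
move=> n Nn; rewrite -[n]odd_double_half addnC.
have /step[] : ((Num.truncn (B / (k / 8))).+1 <= n./2)%N.
  by rewrite -(doubleK (_.+1)) half_leq.
rewrite /preimage /= => W0 W1.
by case: (odd n); rewrite ?addn1 ?addn0 /= iter_P1_map_double.
Qed.

End Dynamics.

(** * Instability of the extremal fixed points, and the equivalence *)

Section Main.
Variable R : realType.
Implicit Types (a b c x y t : R) (z w : R[i]) (f g : {poly R}).

(** If all roots of [P - v] were at squared distance at least [e] from [z], the factorization would
    bound |P(z) - v|^2 below by the chosen [d]. *)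
Lemma horner_open (P : {poly R[i]}) z e : (1 < size P)%N -> 0 < e ->
  exists2 d, 0 < d & forall v, normsq (v - P.[z]) < d ->
    exists2 w, P.[w] = v & normsq (w - z) < e.
Proof.
move=> sP e0.
have P0 : P != 0 by rewrite -size_poly_gt0 (ltn_trans _ sP).
exists (normsq (lead_coef P) * e ^+ (size P).-1).
  by rewrite mulr_gt0 ?exprn_gt0// normsq_gt0 lead_coef_eq0.
move=> v; have [//|nw] := pselect (exists2 w, P.[w] = v & normsq (w - z) < e).
have sv : (size (- v%:P) < size P)%N.
  by rewrite size_polyN (leq_ltn_trans (size_polyC_leq1 _)).
have [r [sr|Q0] [rr Pr]] := normsq_horner_factored (P - v%:P); last first.
  by move: sP; rewrite -(size_polyDl sv) Q0 size_poly0.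
rewrite size_polyDl// in sr; have := Pr z.
rewrite lead_coefDl// hornerD hornerN hornerC -normsqN opprB => ->.
rewrite sr ltNge => /negP[]; rewrite ler_wpM2l ?normsq_ge0//.
have {}rr w : w \in r -> e <= normsq (z - w).
  move/rr; rewrite rootE hornerD hornerN hornerC subr_eq0 => /eqP Pw.
  rewrite leNgt; apply/negP => we.
  by apply: nw; exists w; rewrite // -normsqN opprB.
elim: r rr {sr Pr} => [|w r IH] rr; first by rewrite big_nil.
rewrite big_cons exprS ler_pM ?exprn_ge0 ?(ltW e0) ?rr ?mem_head//.
by apply: IH => v' v'r; rewrite rr// inE v'r orbT.
Qed.

(** Otherwise the orbit increases to a limit, which would be a fixed point of [phi] beyond [b]. *)
Lemma iter_escape (phi : R -> R) b y : continuous phi ->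
  (forall x, b < x -> x < phi x) -> b < y ->
  exists n, b + 1 <= iter n phi y.
Proof.
move=> cphi H yb; apply: contrapT => nex.
pose u n := iter n phi y.
have ub n : b < u n by elim: n => //= n IH; exact: lt_trans IH (H _ IH).
have ui : nondecreasing_seq u.
  by apply/nondecreasing_seqP => n; apply: ltW; exact: H (ub n).
have ux n : u n < b + 1 by rewrite ltNge; apply/negP => h; apply: nex; exists n.
have cu : cvgn u.
  apply: nondecreasing_is_cvgn => //.
  by exists (b + 1) => _ [n _ <-]; exact: ltW.
have yl : y <= limn u by exact: (nondecreasing_cvgn_le ui cu 0).
have lim1 : phi (u n) @[n --> \oo] --> phi (limn u).
  by apply: continuous_cvg; [exact: cphi | exact: cu].
have lim2 : phi (u n) @[n --> \oo] --> limn u.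
  have -> : (fun n => phi (u n)) = (fun n => u n.+1) by [].
  by rewrite (cvg_shiftS u).
have E : phi (limn u) = limn u by apply: cvg_unique lim1 lim2.
by have := H _ (lt_le_trans yb yl); rewrite E ltxx.
Qed.

(** Only real perturbations are tested, since real orbits escape monotonically beyond the extremal
    fixed points. *)
Definition unstable g c := forall d, 0 < d ->
  exists2 y, (y - c) ^+ 2 < d & exists n, 1 <= (iter n (horner g) y - c) ^+ 2.

Lemma unstable_right g b : (forall x, b < x -> x < g.[x]) -> unstable g b.
Proof.
move=> H d d0; pose h := Num.min 1 (d / 2).
have h0 : 0 < h by rewrite lt_min ltr01 divr_gt0.
have h1 : h <= 1 by rewrite ge_min lexx.
have hd : h <= d / 2 by rewrite ge_min lexx orbT.
exists (b + h); first by rewrite addrAC subrr add0r; nra.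
have [|n] := @iter_escape (horner g) b (b + h) (@continuous_horner _ g) H.
  by rewrite ltrDl.
by exists n; nra.
Qed.

Lemma unstable_left g a : (forall x, x < a -> g.[x] < x) -> unstable g a.
Proof.
move=> H; pose h := - (g \Po (- 'X)).
have hE x : h.[x] = - g.[- x] by rewrite /h hornerN horner_comp hornerN hornerX.
have hI n x : iter n (horner h) x = - iter n (horner g) (- x).
  by elim: n => [|n /= ->]; rewrite ?opprK// hE opprK.
move=> d d0; have [|y yd [n yn]] := @unstable_right h (- a) _ d d0.
  by move=> x; rewrite ltrNl => /H; rewrite hE ltrNr.
exists (- y); first by move: yd; rewrite opprK -sqrrN opprD.
by exists n; move: yn; rewrite hI opprK -sqrrN opprD opprK.
Qed.

Lemma iter_horner_mapC g n x :
  iter n (fun w => (mapC g).[w]) (toC x) = toC (iter n (horner g) x).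
Proof. by elim: n => //= n ->; rewrite horner_mapC. Qed.

(** Openness lifts a nearby real point that moves away from [c] to a point near [z], while the orbit
    of [z] stays at [c]: equicontinuity fails. *)
Lemma unstable_preimage_julia f c z : (1 < size (f \Po f))%N ->
  Fix (f \Po f) c -> unstable (f \Po f) c ->
  (mapC (f \Po f)).[z] = toC c -> julia (P1_map f) (Some z).
Proof.
set g := f \Po f => sg gc uc gz Fz.
have gn n : iter n (horner g) c = c by elim: n => //= n ->.
have : nbhs (Some (toC c) : P1 R)
    [set p | if p is Some w then normsq (w - toC c) < 1 else False].
  by apply/nbhs_Some_normsq; exists 1.
rewrite -nbhs_entourageE => -[E entE Ec].
have := fatou_near Fz entE => /nbhs_Some_normsq[e e0 He].
have [|d d0 Hd] := @horner_open (mapC g) z e _ e0.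
  by rewrite size_map_poly.
have [y yd [n yn]] := uc d d0.
have [|w gw wz] := Hd (toC y).
  by rewrite gz -rmorphB normsqR.
(* One application of [g] leads to [c] and [y], and [n] more separate them; each is two steps of
   [f]. *)
have := He w wz (n.+1).*2; rewrite !iter_P1_map_double -/g !iterSr gz gw.
rewrite !iter_horner_mapC gn => /mem_set /Ec /=.
by rewrite -rmorphB normsqR ltNge yn.
Qed.

Lemma real_fibre_in_segment g a b t :
  (forall x, x < a -> g.[x] < x) -> (forall x, b < x -> x < g.[x]) ->
  a <= t <= b -> (forall w, (mapC g).[w] = toC t -> complex.Im w = 0) ->
  fibre_in_segment g a b t.
Proof.
move=> ga gb /andP[at_ tb] H w wt; have := H w wt.
case: w wt => x y /= + y0.
rewrite y0 -[Complex x 0]/(toC x) horner_mapC => -[gx].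
apply/in_segmentP; exists x => //.
rewrite !leNgt; apply/andP; split; apply/negP => h.
  by have := ga _ h; rewrite gx ltNge (le_trans _ at_)// ltW.
by have := gb _ h; rewrite gx ltNge (le_trans tb)// ltW.
Qed.

(** If [a = b], then [g - b] is a multiple of a power of ['X - b] with exponent at least 2, so just
    to the right of [b] the map [g] contracts towards [b], against the third condition. *)
Lemma extremal_fixpoints_lt g a b : (2 < size g)%N -> a <= b ->
  (forall x, x < a -> g.[x] < x) -> (forall x, b < x -> x < g.[x]) ->
  fibre_in_segment g a b b -> a < b.
Proof.
move=> sg ab ga gb fb; rewrite lt_neqAle ab andbT; apply/eqP => eab; subst a.
have sg1 := ltnW sg.
have [r [sr|Q0] [rr Pr]] :=
  normsq_horner_factored (mapC g - (toC b)%:P); last first.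
  by move: sg; rewrite -(size_mapC_subC b sg1) Q0 size_poly0.
have {}rr w : w \in r -> w = toC b.
  move/rr; rewrite rootE hornerD hornerN hornerC subr_eq0 => /eqP /fb.
  by move=> /in_segmentP[x /andP[bx xb] ->]; congr (toC _); apply/le_anti/andP.
rewrite size_mapC_subC// in sr; rewrite sr ltnS in sg.
have A0 : 0 < normsq (lead_coef (mapC g - (toC b)%:P)).
  rewrite normsq_gt0 lead_coef_eq0 -size_poly_gt0.
  by rewrite size_mapC_subC// (ltn_trans _ sg1).
(* This [h] satisfies [h < 1] and [A * h < 1], hence [A * h ^+ 4 < h ^+ 2]. *)
set A := normsq _ in A0 Pr; pose h := (1 + A)^-1.
have h0 : 0 < h by rewrite invr_gt0 addr_gt0.
have h1 : h * (1 + A) = 1 by rewrite mulVf// gt_eqF// addr_gt0.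
have gh : b + h < g.[b + h] by apply: gb; rewrite ltrDl.
have := Pr (toC (b + h)).
rewrite hornerD hornerN hornerC horner_mapC -rmorphB normsqR.
have -> : \prod_(x <- r) normsq (toC (b + h) - x) = (h ^+ 2) ^+ size r.
  elim: r rr {sr Pr sg} => [|w r IH] rr; first by rewrite big_nil.
  rewrite big_cons IH => [|v vr]; last by apply: rr; rewrite inE vr orbT.
  rewrite /= [RHS]exprS (rr w (mem_head _ _)).
  by rewrite -rmorphB normsqR addrAC subrr add0r.
have : (h ^+ 2) ^+ size r <= (h ^+ 2) ^+ 2.
  apply: ler_wiXn2l => //; first exact: sqr_ge0.
  by nra.
set k := _ ^+ size r => hk E.
have : h ^+ 2 < (g.[b + h] - b) ^+ 2 by nra.
rewrite E; have : A * k <= A * (h ^+ 2) ^+ 2 by rewrite ler_pM2l.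
have : A * (h ^+ 2) < 1 by nra.
have : 0 < h ^+ 2 by rewrite exprn_gt0.
nra.
Qed.

End Main.

Theorem proposition1p2 (R : realType) (f : {poly R}) (d : nat)
    (hd : size f = d.+1) (hodd : odd d) (hd3 : (3 <= d)%N)
    (hlead : lead_coef f < 0) :
  julia (P1_map f) `<=` @real_line R <->
  Fix (f \Po f) `<=` critical_interval (f \Po f).
Proof.
set g := f \Po f.
have sf : (1 < size f)%N by rewrite hd ltnS (ltn_trans _ hd3).
have sgE : (size g).-1 = (d * d)%N by rewrite size_comp_poly hd.
have dd : (2 < d * d)%N.
  by rewrite (leq_trans hd3)// leq_pmulr// (ltn_trans _ hd3).
have sg : (2 < size g)%N by rewrite (leq_trans dd)// -sgE leq_pred.
have sg1 := ltnW sg.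
have og : ~~ odd (size g).
  by rewrite -(prednK (ltnW sg1)) sgE /= oddM hodd.
(* The leading coefficient of [g] is that of [f] to the power [d + 1], which is even. *)
have lg : 0 < lead_coef g.
  by rewrite lead_coef_comp// hd /= -exprS exprn_even_gt0 /= ?hodd// lt_eqF.
have [c Fc] := Fix_neq0 og sg.
have [a Fa ga] := first_fixpoint og sg lg (ex_intro _ c Fc).
have [b Fb gb] := last_fixpoint sg lg (ex_intro _ c Fc).
have Fix_itv x : Fix g x -> a <= x <= b.
  move=> Fx; rewrite !leNgt; apply/andP; split; apply/negP => h.
    by have := ga _ h; rewrite Fx ltxx.
  by have := gb _ h; rewrite Fx ltxx.
have ab : a <= b by have /andP[] := Fix_itv b Fb.
have ha : a <= a <= b by rewrite lexx.
have hb : a <= b <= b by rewrite lexx ab.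
have fibre_end t : Fix g t ->
    (forall w, (mapC g).[w] = toC t -> complex.Im w = 0) ->
    fibre_in_segment g a b t.
  by move=> /Fix_itv; exact: real_fibre_in_segment.
split=> H.
  have fib t : Fix g t -> unstable g t -> fibre_in_segment g a b t.
    move=> Ft ut; apply: fibre_end => // w gw.
    by have [x _ [<-]] := H _ (unstable_preimage_julia sg1 Ft ut gw).
  have fb := fib b Fb (unstable_right gb).
  have fa := fib a Fa (unstable_left ga).
  have ltab := extremal_fixpoints_lt sg ab ga gb fb.
  (* The fixed point [x] lies in the segment, hence so does its whole complex fibre, which is
     therefore real. *)
  move=> x Fx; apply/mem_critical_interval => // w gw.
  suff /in_segmentP[y _ ->] : in_segment a b w by [].
  apply: (segment_preimage ltab sg1 fa fb); rewrite gw.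
  by apply/in_segmentP; exists x => //; exact: Fix_itv.
have fib t : Fix g t -> fibre_in_segment g a b t.
  move=> Ft; apply: fibre_end => //.
  by apply/mem_critical_interval => //; exact: H.
have ltab := extremal_fixpoints_lt sg ab ga gb (fib b Fb).
(* [off_segment] contains infinity, so a Julia point can only be a point of the real segment. *)
move=> p Jp; have [Up|] := pselect (off_segment a b p).
  by case: Jp; exact: (off_segment_fatou ltab sf sg (fib a Fa) (fib b Fb)).
case: p {Jp} => [w|] nU; last by case: nU.
move/negP: nU; rewrite negbK => /in_segmentP[x _ ->].
by exists x.
Qed.
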